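(* Let $\lambda\in\mathbb{C}$ with $\operatorname{Re}\lambda\in[0,\tfrac12]$ and $10\le|\operatorname{Im}\lambda|\le 380$. Then there is no unstable mode for $\lambda$, i.e. there is no nontrivial (not identically zero) complex-valued function $u_\lambda\in C^\infty[0,1]$ satisfying $$-(1-\rho^2)u_\lambda''(\rho)-2\frac{1-\rho^2}{\rho}u_\lambda'(\rho)+2\lambda\rho\, u_\lambda'(\rho)+\lambda(\lambda+1)u_\lambda(\rho)+\frac{V(\rho)}{\rho^2}u_\lambda(\rho)=0\qquad\text{for }\rho\in(0,1),$$ where $V(\rho)=2\cos(4\arctan\rho)=\frac{2(1-6\rho^2+\rho^4)}{(1+\rho^2)^2}$.
   Context: An unstable mode for $\lambda\in\mathbb{C}$ with $\operatorname{Re}\lambda\ge0$ is a nontrivial solution $u_\lambda\in C^\infty[0,1]$ of the ODE in the claim. $C^\infty[0,1]$ denotes complex-valued functions smooth up to and including the endpoints. *)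

(* Defs.v *)
From Stdlib Require Import Reals Lra.
From Coquelicot Require Import Coquelicot.
Open Scope R_scope.

(** [f] has derivative [l] at [x] relative to [0,1]: the library's [is_derive]
    with the neighbourhood filter restricted to [0,1], hence one-sided at the
    two endpoints. The complex plane is taken as a normed space over R. *)
Definition is_derive_01 (f : R -> C) (x : R) (l : C) : Prop :=
  @filterdiff R_AbsRing R_NormedModule C_R_NormedModule
    f (within (fun y => 0 <= y <= 1) (locally x))
    (fun h : R => @scal R_AbsRing C_R_NormedModule h l).

(** [D n] plays the role of the n-th derivative. Only the values of [u] on
    [0,1] matter. *)
Definition smooth_01 (u : R -> C) : Prop :=
  exists D : nat -> R -> C,
    (forall x, 0 <= x <= 1 -> D 0%nat x = u x) /\
    (forall n x, 0 <= x <= 1 -> is_derive_01 (D n) x (D (S n) x)).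

(** Componentwise total derivatives, two-sided: meaningful in the open interval,
    where they agree with [smooth_01]'s derivatives. *)
Definition Derive_n_C (u : R -> C) (n : nat) (x : R) : C :=
  (Derive_n (fun t => Re (u t)) n x, Derive_n (fun t => Im (u t)) n x).

Definition V (rho : R) : R := 2 * cos (4 * atan rho).

Lemma V_rational (rho : R) :
  V rho = 2 * (1 - 6 * rho ^ 2 + rho ^ 4) / (1 + rho ^ 2) ^ 2.
Proof.
unfold V.
replace (4 * atan rho) with (2 * (2 * atan rho)) by ring.
rewrite 2!cos_2a_cos.
assert (Hc : cos (atan rho) * cos (atan rho) = / (1 + rho ^ 2)).
{ rewrite cos_atan.
  assert (H : 0 < 1 + rho ^ 2) by (generalize (pow2_ge_0 rho); lra).
  unfold Rsqr; replace (rho * rho) with (rho ^ 2) by ring.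
  rewrite <- (sqrt_sqrt (1 + rho ^ 2)) at 3 by lra.
  field.
  apply Rgt_not_eq, sqrt_lt_R0, H. }
replace (2 * cos (atan rho) * cos (atan rho)) with
  (2 * (cos (atan rho) * cos (atan rho))) by ring.
rewrite Hc; field.
generalize (pow2_ge_0 rho); lra.
Qed.

Definition mode_equation (lambda : C) (u : R -> C) (rho : R) : Prop :=
  (- RtoC (1 - rho ^ 2) * Derive_n_C u 2 rho
   - RtoC (2 * ((1 - rho ^ 2) / rho)) * Derive_n_C u 1 rho
   + 2 * lambda * RtoC rho * Derive_n_C u 1 rho
   + lambda * (lambda + 1) * u rho
   + RtoC (V rho / rho ^ 2) * u rho)%C = RtoC 0.

Definition unstable_mode (lambda : C) (u : R -> C) : Prop :=
  0 <= Re lambda /\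
  smooth_01 u /\
  (exists rho, 0 <= rho <= 1 /\ u rho <> RtoC 0) /\
  (forall rho, 0 < rho < 1 -> mode_equation lambda u rho).

(* Main.v *)
(** With [s = 1 - lambda] and [v = rho u], the function [h = (1 + rho)^(-s) v]
    satisfies [((1 - rho^2) h')' + 2 s h' = (V / rho^2) h]. In the variable
    [x = artanh rho] it reads [h_xx + 2 s h_x = q h] with [q = (1 - rho^2) V / rho^2],
    so that [(|h_x|^2 - q |h|^2)_x = - 4 (Re s) |h_x|^2 - q_x |h|^2]. Since [u]
    vanishes at the origin and [Re s <= 1], this forces [|h_x|^2 >= q |h|^2] as
    long as [q > 0], in particular at [rho = 1/3]: there [h] varies fast.

    On the other hand, smoothness at [rho = 1] forces [h' = k h] there, where
    [k = V / (2 rho^2 (s - rho))] solves the equation to leading order in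
    [1 / s]. A Riccati comparison, run backwards from [1], keeps
    [|h' - k h| <= eta |h|] on [[1/3, 1]] for an explicit [eta]; it uses only
    [Re s <= 1] and [|s - rho| >= 10]. At [1/3] this makes [|h_x|] too small
    for the first estimate unless [h] vanishes there, and then both monotone
    quantities are constant, which gives [u = 0]. *)

Require Import Defs.
From Stdlib Require Import Reals Lra Psatz.
From Coquelicot Require Import Coquelicot.
Open Scope R_scope.

(** * Modes extended to the real line *)

(** The projection onto [0,1]. The derivatives of a mode are known only relative to that interval;
    since this map is 1-Lipschitz, composing with it gives functions continuous on the whole line,
    so that two-sided continuity is available at the endpoints. *)
Definition clamp (x : R) : R := Rmax 0 (Rmin x 1).

Lemma clamp_01 (x : R) : 0 <= clamp x <= 1.
Proof.
unfold clamp; split; [apply Rmax_l|].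
apply Rmax_lub; [lra | apply Rmin_r].
Qed.

Lemma clamp_id (x : R) : 0 <= x <= 1 -> clamp x = x.
Proof. intros Hx; unfold clamp; rewrite Rmin_left, Rmax_right; lra. Qed.

Lemma clamp_lipschitz (x y : R) : Rabs (clamp y - clamp x) <= Rabs (y - x).
Proof.
unfold clamp, Rmax, Rmin.
repeat destruct Rle_dec; unfold Rabs; repeat destruct Rcase_abs; lra.
Qed.

Lemma locally_open_01 (x : R) : 0 < x < 1 -> locally x (fun y => 0 < y < 1).
Proof.
intros Hx.
apply (open_and (fun y => 0 < y) (fun y => y < 1));
  [apply open_gt | apply open_lt | exact Hx].
Qed.

Definition continuous_C (f : R -> C) (x : R) : Prop :=
  continuity_pt (fun t => Re (f t)) x /\ continuity_pt (fun t => Im (f t)) x.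

Lemma is_derive_01_continuous (f : R -> C) (l : C) (x : R) :
  is_derive_01 f (clamp x) l ->
  continuous_C (fun t => f (clamp t)) x.
Proof.
intros H.
assert (Hc : filterlim f (within (fun y => 0 <= y <= 1) (locally (clamp x)))
               (@locally C_R_NormedModule (f (clamp x)))).
{ apply (@filterdiff_continuous_aux R_AbsRing R_NormedModule C_R_NormedModule).
  - apply within_filter, locally_filter.
  - eexists; exact H.
  - intros P HP; apply filter_le_within; exact HP. }
assert (Hcl : @continuous R_UniformSpace C_R_NormedModule (fun t => f (clamp t)) x).
{ apply filterlim_comp with (2 := Hc).
  intros P [eps HP]; exists eps; intros y Hy.
  apply HP; [|apply clamp_01].
  exact (Rle_lt_trans _ _ _ (clamp_lipschitz x y) Hy). }
split; apply continuity_pt_filterlim.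
- exact (continuous_comp (fun t => f (clamp t)) fst x Hcl
    (filterdiff_continuous_aux _ (ex_intro _ _ (filterdiff_linear _
      (@is_linear_fst R_AbsRing R_NormedModule R_NormedModule))) _ (fun P HP => HP))).
- exact (continuous_comp (fun t => f (clamp t)) snd x Hcl
    (filterdiff_continuous_aux _ (ex_intro _ _ (filterdiff_linear _
      (@is_linear_snd R_AbsRing R_NormedModule R_NormedModule))) _ (fun P HP => HP))).
Qed.

Definition is_derive_C (f : R -> C) (x : R) (l : C) : Prop :=
  is_derive (fun t => Re (f t)) x (Re l) /\
  is_derive (fun t => Im (f t)) x (Im l).

Lemma is_derive_01_interior (f : R -> C) (l : C) (x : R) :
  0 < x < 1 -> is_derive_01 f x l -> is_derive_C f x l.
Proof.
intros Hx [Hl Hd].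
assert (Hf : @is_derive R_AbsRing C_R_NormedModule f x l).
{ split; [exact Hl|].
  intros y Hy eps.
  assert (Hy' : is_filter_lim (within (fun y => 0 <= y <= 1) (locally x)) y)
    by (intros P HP; apply filter_le_within, Hy, HP).
  generalize (filter_and _ _ (locally_open_01 x Hx) (Hd y Hy' eps)).
  apply filter_imp; intros z [Hz H]; apply H; lra. }
split.
- exact (filterdiff_comp' f _ x _ _ Hf (filterdiff_linear _
      (@is_linear_fst R_AbsRing R_NormedModule R_NormedModule))).
- exact (filterdiff_comp' f _ x _ _ Hf (filterdiff_linear _
      (@is_linear_snd R_AbsRing R_NormedModule R_NormedModule))).
Qed.

(* [u], [u1], [u2] stand for a mode and its first two derivatives; the
   equation is multiplied by [x ^ 2], so that it makes sense, and by
   continuity holds, up to the endpoints. *)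
Record regular_solution (lambda : C) (u u1 u2 : R -> C) : Prop := {
  rs_cont : forall x, continuous_C u x;
  rs_cont1 : forall x, continuous_C u1 x;
  rs_derive : forall x, 0 < x < 1 -> is_derive_C u x (u1 x);
  rs_derive1 : forall x, 0 < x < 1 -> is_derive_C u1 x (u2 x);
  rs_eq : forall x, 0 <= x <= 1 ->
    (RtoC (x ^ 2 * (1 - x ^ 2)) * u2 x =
     RtoC x * (2 * lambda * RtoC (x ^ 2) - RtoC (2 * (1 - x ^ 2))) * u1 x
     + (lambda * (lambda + 1) * RtoC (x ^ 2) + RtoC (V x)) * u x)%C }.

(** Derivatives are local: agreement of [u] with [D0] on the open interval identifies the first
    derivative near [x], and not only at [x], as the second derivative requires. *)
Lemma Derive_n_C_eq (u D0 D1 : R -> C) (l : C) (x : R) :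
  0 < x < 1 ->
  (forall y, 0 < y < 1 -> u y = D0 y) ->
  (forall y, 0 < y < 1 -> is_derive_C D0 y (D1 y)) ->
  is_derive_C D1 x l ->
  Derive_n_C u 1 x = D1 x /\ Derive_n_C u 2 x = l.
Proof.
intros Hx Hu H0 [H1r H1i].
assert (Hd : forall y, 0 < y < 1 ->
  Derive (fun t => Re (u t)) y = Re (D1 y) /\ Derive (fun t => Im (u t)) y = Im (D1 y)).
{ intros y Hy; destruct (H0 y Hy) as [Hr Hi].
  split; apply is_derive_unique.
  - apply is_derive_ext_loc with (2 := Hr).
    generalize (locally_open_01 y Hy); apply filter_imp; intros z Hz.
    rewrite Hu; auto.
  - apply is_derive_ext_loc with (2 := Hi).
    generalize (locally_open_01 y Hy); apply filter_imp; intros z Hz.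
    rewrite Hu; auto. }
split; unfold Derive_n_C; simpl.
- replace (Derive (fun t => Re (u t)) x) with (Re (D1 x)) by (symmetry; apply Hd, Hx).
  replace (Derive (fun t => Im (u t)) x) with (Im (D1 x)) by (symmetry; apply Hd, Hx).
  symmetry; apply surjective_pairing.
- rewrite (surjective_pairing l); f_equal; apply is_derive_unique.
  + apply is_derive_ext_loc with (2 := H1r).
    generalize (locally_open_01 x Hx); apply filter_imp; intros z Hz.
    symmetry; apply (proj1 (Hd z Hz)).
  + apply is_derive_ext_loc with (2 := H1i).
    generalize (locally_open_01 x Hx); apply filter_imp; intros z Hz.
    symmetry; apply (proj2 (Hd z Hz)).
Qed.

Lemma continuous_C_RtoC (f : R -> R) (x : R) :
  continuity_pt f x -> continuous_C (fun t => RtoC (f t)) x.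
Proof.
intros H; split; [exact H|].
apply continuity_pt_const; intros ? ?; reflexivity.
Qed.

Lemma continuous_C_const (z : C) (x : R) : continuous_C (fun _ => z) x.
Proof. split; apply continuity_pt_const; intros ? ?; reflexivity. Qed.

Lemma continuous_C_plus (f g : R -> C) (x : R) :
  continuous_C f x -> continuous_C g x -> continuous_C (fun t => (f t + g t)%C) x.
Proof. intros [Hf Hf'] [Hg Hg']; split; apply continuity_pt_plus; assumption. Qed.

Lemma continuous_C_minus (f g : R -> C) (x : R) :
  continuous_C f x -> continuous_C g x -> continuous_C (fun t => (f t - g t)%C) x.
Proof.
intros [Hf Hf'] [Hg Hg']; split.
- exact (continuity_pt_minus _ _ _ Hf Hg).
- exact (continuity_pt_minus _ _ _ Hf' Hg').
Qed.

Lemma continuous_C_mult (f g : R -> C) (x : R) :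
  continuous_C f x -> continuous_C g x -> continuous_C (fun t => (f t * g t)%C) x.
Proof.
intros [Hf Hf'] [Hg Hg']; split.
- exact (continuity_pt_minus _ _ _ (continuity_pt_mult _ _ _ Hf Hg)
    (continuity_pt_mult _ _ _ Hf' Hg')).
- exact (continuity_pt_plus _ _ _ (continuity_pt_mult _ _ _ Hf Hg')
    (continuity_pt_mult _ _ _ Hf' Hg)).
Qed.

Lemma ex_derive_continuity_pt (f : R -> R) (x : R) : ex_derive f x -> continuity_pt f x.
Proof. intros H; apply continuity_pt_filterlim; exact (ex_derive_continuous f x H). Qed.

Lemma ex_derive_V (x : R) : ex_derive V x.
Proof. unfold V; auto_derive; exact I. Qed.

Lemma zero_on_closed_01 (f : R -> R) :
  (forall x, continuity_pt f x) -> (forall x, 0 < x < 1 -> f x = 0) ->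
  forall x, 0 <= x <= 1 -> f x = 0.
Proof.
intros Hc H0 x Hx.
destruct (Req_dec (f x) 0) as [|Hne]; [assumption|exfalso].
destruct (Hc x (Rabs (f x)) (Rabs_pos_lt _ Hne)) as [d [Hd Hnear]].
simpl in Hnear; unfold R_dist, D_x, no_cond in Hnear.
(* Moving [x] towards the midpoint by at most 1/4 keeps the new point inside (0,1), even from an
   endpoint. *)
assert (Hy : exists y, 0 < y < 1 /\ x <> y /\ Rabs (y - x) < d).
{ assert (Hm : 0 < Rmin d (1 / 2) / 2) by (apply Rdiv_lt_0_compat; [apply Rmin_pos|]; lra).
  generalize (Rmin_l d (1 / 2)) (Rmin_r d (1 / 2)); intros Hl Hr.
  destruct (Rle_dec x (1 / 2)).
  - exists (x + Rmin d (1 / 2) / 2); rewrite Rabs_pos_eq; lra.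
  - exists (x - Rmin d (1 / 2) / 2); rewrite Rabs_left; lra. }
destruct Hy as [y [Hy01 [Hxy Hyd]]].
specialize (Hnear y (conj (conj I Hxy) Hyd)).
rewrite (H0 y Hy01), Rminus_0_l, Rabs_Ropp in Hnear; lra.
Qed.

Lemma C_zero_on_closed_01 (f : R -> C) :
  (forall x, continuous_C f x) -> (forall x, 0 < x < 1 -> f x = RtoC 0) ->
  forall x, 0 <= x <= 1 -> f x = RtoC 0.
Proof.
intros Hc H0 x Hx.
rewrite (surjective_pairing (f x)); unfold RtoC; f_equal.
- apply (zero_on_closed_01 (fun t => Re (f t))); [apply Hc| |exact Hx].
  intros y Hy; rewrite H0; auto.
- apply (zero_on_closed_01 (fun t => Im (f t))); [apply Hc| |exact Hx].
  intros y Hy; rewrite H0; auto.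
Qed.

Lemma unstable_mode_regular_solution (lambda : C) (u : R -> C) :
  unstable_mode lambda u ->
  exists w w1 w2, regular_solution lambda w w1 w2 /\
    exists x, 0 <= x <= 1 /\ w x <> RtoC 0.
Proof.
intros [_ [[D [HD0 HD]] [[x0 [Hx0 Hne]] Heq]]].
assert (Hcont : forall n x, continuous_C (fun t => D n (clamp t)) x).
{ intros n x; exact (is_derive_01_continuous _ _ _ (HD n _ (clamp_01 x))). }
assert (Hder : forall n x, 0 < x < 1 ->
  is_derive_C (fun t => D n (clamp t)) x (D (S n) (clamp x))).
{ intros n x Hx.
  rewrite (clamp_id x) by lra.
  assert (Hloc : locally x (fun t => D n t = D n (clamp t))).
  { generalize (locally_open_01 x Hx); apply filter_imp; intros z Hz.
    rewrite clamp_id; [reflexivity|lra]. }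
  assert (Hd : is_derive_C (D n) x (D (S n) x)).
  { apply is_derive_01_interior; [exact Hx|apply HD; lra]. }
  destruct Hd as [Hr Hi]; split.
  - apply is_derive_ext_loc with (2 := Hr).
    generalize Hloc; apply filter_imp; intros z Hz; rewrite Hz; reflexivity.
  - apply is_derive_ext_loc with (2 := Hi).
    generalize Hloc; apply filter_imp; intros z Hz; rewrite Hz; reflexivity. }
exists (fun t => D 0%nat (clamp t)), (fun t => D 1%nat (clamp t)), (fun t => D 2%nat (clamp t)).
split.
2: { exists x0; split; [exact Hx0|]; rewrite clamp_id, HD0; assumption. }
split; try apply Hcont; try apply Hder.
intros x Hx.
match goal with |- ?l = ?r => cut ((l - r)%C = RtoC 0) end.
{ intros H; match goal with |- ?l = ?r => replace l with ((l - r) + r)%C by ring end.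
  rewrite H; ring. }
(* The difference of the two sides is continuous, so it is enough that it vanishes on the open
   interval. *)
revert x Hx; apply (C_zero_on_closed_01 (fun x =>
  (RtoC (x ^ 2 * (1 - x ^ 2)) * D 2%nat (clamp x) -
   (RtoC x * (2 * lambda * RtoC (x ^ 2) - RtoC (2 * (1 - x ^ 2))) * D 1%nat (clamp x)
     + (lambda * (lambda + 1) * RtoC (x ^ 2) + RtoC (V x)) * D 0%nat (clamp x)))%C)).
{ intros x.
  repeat first [ apply Hcont | apply continuous_C_const
    | apply continuous_C_minus | apply continuous_C_plus | apply continuous_C_mult
    | apply continuous_C_RtoC, ex_derive_continuity_pt, ex_derive_V
    | apply continuous_C_RtoC, ex_derive_continuity_pt; auto_derive; exact I ]. }
intros x Hx.
destruct (Derive_n_C_eq u (fun t => D 0%nat (clamp t)) (fun t => D 1%nat (clamp t))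
  (D 2%nat (clamp x)) x Hx) as [H1 H2].
{ intros y Hy; rewrite clamp_id, HD0; auto; lra. }
{ intros y Hy; exact (Hder 0%nat y Hy). }
{ exact (Hder 1%nat x Hx). }
generalize (Heq x Hx); unfold mode_equation; rewrite H1, H2.
rewrite <- (HD0 x), (clamp_id x) by lra.
intros HE.
assert (Hxc : RtoC x <> RtoC 0) by (intros Hc; apply RtoC_inj in Hc; lra).
(* The difference is [- x ^ 2] times the left side of the mode equation. *)
replace (RtoC 0) with (- RtoC (x ^ 2) * RtoC 0)%C by ring.
rewrite <- HE.
rewrite !RtoC_mult, !RtoC_div, !RtoC_minus, !RtoC_pow by (try apply pow_nonzero; lra).
field; assumption.
Qed.

(** * Componentwise calculus in the complex plane *)

Lemma is_derive_C_RtoC (f : R -> R) (x l : R) :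
  is_derive f x l -> is_derive_C (fun t => RtoC (f t)) x (RtoC l).
Proof.
intros H; split; [exact H|exact (is_derive_const 0 x)].
Qed.

Lemma is_derive_C_const (z : C) (x : R) : is_derive_C (fun _ => z) x (RtoC 0).
Proof. split; [exact (is_derive_const (Re z) x)|exact (is_derive_const (Im z) x)]. Qed.

Lemma is_derive_C_plus (f g : R -> C) (x : R) (l m : C) :
  is_derive_C f x l -> is_derive_C g x m -> is_derive_C (fun t => (f t + g t)%C) x (l + m)%C.
Proof.
intros [Hf Hf'] [Hg Hg']; split.
- exact (is_derive_plus _ _ _ _ _ Hf Hg).
- exact (is_derive_plus _ _ _ _ _ Hf' Hg').
Qed.

Lemma is_derive_C_minus (f g : R -> C) (x : R) (l m : C) :
  is_derive_C f x l -> is_derive_C g x m -> is_derive_C (fun t => (f t - g t)%C) x (l - m)%C.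
Proof.
intros [Hf Hf'] [Hg Hg']; split.
- exact (is_derive_minus _ _ _ _ _ Hf Hg).
- exact (is_derive_minus _ _ _ _ _ Hf' Hg').
Qed.

Lemma is_derive_C_mult (f g : R -> C) (x : R) (l m : C) :
  is_derive_C f x l -> is_derive_C g x m ->
  is_derive_C (fun t => (f t * g t)%C) x (l * g x + f x * m)%C.
Proof.
intros [Hf Hf'] [Hg Hg'].
assert (Hm : forall p q l' m', is_derive p x l' -> is_derive q x m' ->
  is_derive (fun t => p t * q t) x (l' * q x + p x * m')).
{ intros p q l' m' Hp Hq.
  exact (is_derive_mult p q x l' m' Hp Hq Rmult_comm). }
split.
- replace (Re (l * g x + f x * m)%C) with
    ((Re l * Re (g x) + Re (f x) * Re m) - (Im l * Im (g x) + Im (f x) * Im m))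
    by (unfold Re, Im; simpl; ring).
  exact (is_derive_minus _ _ _ _ _ (Hm _ _ _ _ Hf Hg) (Hm _ _ _ _ Hf' Hg')).
- replace (Im (l * g x + f x * m)%C) with
    ((Re l * Im (g x) + Re (f x) * Im m) + (Im l * Re (g x) + Im (f x) * Re m))
    by (unfold Re, Im; simpl; ring).
  exact (is_derive_plus _ _ _ _ _ (Hm _ _ _ _ Hf Hg') (Hm _ _ _ _ Hf' Hg)).
Qed.

Lemma Cmod2 (z : C) : Cmod z ^ 2 = Re z ^ 2 + Im z ^ 2.
Proof.
unfold Cmod; rewrite pow2_sqrt; [reflexivity|].
generalize (pow2_ge_0 (fst z)) (pow2_ge_0 (snd z)); lra.
Qed.

Lemma Cmod2_neq_0 (z : C) : z <> RtoC 0 -> 0 < Re z ^ 2 + Im z ^ 2.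
Proof. intros Hz; rewrite <- Cmod2; apply pow_lt, Cmod_gt_0, Hz. Qed.

Lemma is_derive_C_inv (f : R -> C) (x : R) (l : C) :
  is_derive_C f x l -> f x <> RtoC 0 ->
  is_derive_C (fun t => (/ f t)%C) x (- l / (f x * f x))%C.
Proof.
intros [Hf Hf'] Hne.
pose proof (Cmod2_neq_0 _ Hne) as Hpos.
(* One real computation serves both components: with f = p + iq, the real part of 1/f is p / (p^2 +
   q^2), and the imaginary part is minus the same expression with p and q exchanged. *)
assert (Hinv : forall p q dp dq, is_derive p x dp -> is_derive q x dq ->
  0 < p x ^ 2 + q x ^ 2 ->
  is_derive (fun t => p t / (p t ^ 2 + q t ^ 2)) x
    ((dp * (q x ^ 2 - p x ^ 2) - 2 * p x * q x * dq) / (p x ^ 2 + q x ^ 2) ^ 2)).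
{ intros p q dp dq Hp Hq H0.
  auto_derive.
  - repeat split; [eexists; exact Hp|eexists; exact Hp|eexists; exact Hq|lra].
  - replace (Derive (fun t => p t) x) with dp by (symmetry; exact (is_derive_unique _ _ _ Hp)).
    replace (Derive (fun t => q t) x) with dq by (symmetry; exact (is_derive_unique _ _ _ Hq)).
    field; lra. }
split.
- replace (Re (- l / (f x * f x))%C) with
    ((Re l * (Im (f x) ^ 2 - Re (f x) ^ 2) - 2 * Re (f x) * Im (f x) * Im l)
       / (Re (f x) ^ 2 + Im (f x) ^ 2) ^ 2).
  { exact (Hinv _ _ _ _ Hf Hf' Hpos). }
  clear - Hpos; unfold Re, Im in *; destruct (f x) as [p q], l as [l1 l2]; simpl in *.
  field; split; [nra|lra].
- replace (Im (- l / (f x * f x))%C) with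
    (- ((Im l * (Re (f x) ^ 2 - Im (f x) ^ 2) - 2 * Im (f x) * Re (f x) * Re l)
       / (Im (f x) ^ 2 + Re (f x) ^ 2) ^ 2)).
  { rewrite Rplus_comm in Hpos.
    generalize (is_derive_opp _ _ _ (Hinv _ _ _ _ Hf' Hf Hpos)).
    apply is_derive_ext; intros t; unfold opp; simpl.
    unfold Re, Im; rewrite (Rplus_comm (snd (f t) * _)); unfold Rdiv; ring. }
  clear - Hpos; unfold Re, Im in *; destruct (f x) as [p q], l as [l1 l2]; simpl in *.
  field; split; [nra|lra].
Qed.

Definition dot (z w : C) : R := Re z * Re w + Im z * Im w.

Lemma is_derive_Cmod2 (f : R -> C) (x : R) (l : C) :
  is_derive_C f x l -> is_derive (fun t => Cmod (f t) ^ 2) x (2 * dot (f x) l).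
Proof.
intros [Hf Hf'].
apply is_derive_ext with (fun t => Re (f t) ^ 2 + Im (f t) ^ 2).
{ intros t; symmetry; apply Cmod2. }
replace (2 * dot (f x) l) with
  (INR 2 * Re l * Re (f x) ^ Nat.pred 2 + INR 2 * Im l * Im (f x) ^ Nat.pred 2)
  by (unfold dot; simpl; ring).
exact (is_derive_plus _ _ _ _ _ (is_derive_pow _ 2 _ _ Hf) (is_derive_pow _ 2 _ _ Hf')).
Qed.

Lemma continuity_pt_Cmod2 (f : R -> C) (x : R) :
  continuous_C f x -> continuity_pt (fun t => Cmod (f t) ^ 2) x.
Proof.
intros [Hf Hf'].
apply continuity_pt_ext with (fun t => Re (f t) * Re (f t) + Im (f t) * Im (f t)).
{ intros t; rewrite Cmod2; ring. }
exact (continuity_pt_plus _ _ _ (continuity_pt_mult _ _ _ Hf Hf)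
  (continuity_pt_mult _ _ _ Hf' Hf')).
Qed.

(** Cauchy-Schwarz, then 2 |v| |e| <= |e|^2 / h + h |v|^2. The weight [h] will be [eta x], which
    spreads a cross term evenly over |e|^2 and eta^2 |v|^2. *)
Lemma two_dot_le (k v e : C) (K h : R) :
  Cmod k <= K -> 0 < h ->
  Rabs (2 * dot (k * v)%C e) <= K * (Cmod e ^ 2 / h + h * Cmod v ^ 2).
Proof.
intros HK Hh.
assert (Hcs : Rabs (dot (k * v)%C e) <= Cmod (k * v)%C * Cmod e).
{ rewrite <- (Rabs_pos_eq (Cmod (k * v)%C * Cmod e))
    by (apply Rmult_le_pos; apply Cmod_ge_0).
  apply Rsqr_le_abs_0; unfold Rsqr.
  replace (Cmod (k * v)%C * Cmod e * (Cmod (k * v)%C * Cmod e)) with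
    (Cmod (k * v)%C ^ 2 * Cmod e ^ 2) by ring.
  rewrite 2!Cmod2; unfold dot.
  set (z := (k * v)%C).
  generalize (pow2_ge_0 (Re z * Im e - Im z * Re e)); nra. }
rewrite Rabs_mult, (Rabs_pos_eq 2) by lra.
rewrite Cmod_mult in Hcs.
assert (Hamgm : 2 * (Cmod v * Cmod e) <= Cmod e ^ 2 / h + h * Cmod v ^ 2).
{ apply Rmult_le_reg_l with h; [exact Hh|].
  replace (h * (Cmod e ^ 2 / h + h * Cmod v ^ 2)) with (Cmod e ^ 2 + (h * Cmod v) ^ 2)
    by (field; lra).
  generalize (pow2_ge_0 (Cmod e - h * Cmod v)); nra. }
assert (H0 := Cmod_ge_0 k).
assert (Hve : 0 <= Cmod v * Cmod e) by (apply Rmult_le_pos; apply Cmod_ge_0).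
apply Rle_trans with (Cmod k * (2 * (Cmod v * Cmod e))); [lra|].
apply Rmult_le_compat; lra.
Qed.

Lemma nondecreasing_from_derive (f df : R -> R) (a b : R) :
  a <= b ->
  (forall x, a <= x <= b -> continuity_pt f x) ->
  (forall x, a < x < b -> is_derive f x (df x)) ->
  (forall x, a < x < b -> 0 <= df x) ->
  f a <= f b.
Proof.
intros Hab Hc Hd Hpos.
destruct (Req_dec a b) as [->|Hne]; [lra|].
(* The intermediate point may be an endpoint, where nothing is known about [df]; taking
   [Rabs (df x)] as the derivative keeps it nonnegative there. *)
destruct (MVT_gen f a b (fun x => Rabs (df x))) as [c [_ Hm]].
- rewrite Rmin_left, Rmax_right by lra; intros x Hx.
  rewrite Rabs_pos_eq; auto.
- rewrite Rmin_left, Rmax_right by lra; exact Hc.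
- generalize (Rmult_le_pos (Rabs (df c)) (b - a) (Rabs_pos _)); lra.
Qed.

(** The rigidity case: a nondecreasing function that does not gain over the interval is constant. It
    turns equality at the matching point into [u = 0] on both sides of it. *)
Lemma derive_zero_of_nondecreasing (f df : R -> R) (a b : R) :
  (forall x, a <= x <= b -> continuity_pt f x) ->
  (forall x, a < x < b -> is_derive f x (df x)) ->
  (forall x, a < x < b -> 0 <= df x) ->
  f b <= f a ->
  forall x, a < x < b -> df x = 0.
Proof.
intros Hc Hd Hpos Hba x Hx.
assert (Hmono : forall y z, a <= y -> y <= z -> z <= b -> f y <= f z).
{ intros y z Hy Hyz Hz; apply (nondecreasing_from_derive f df); intros; auto with real.
  - apply Hc; lra.
  - apply Hd; lra.
  - apply Hpos; lra. }
assert (Hconst : locally x (fun y => f a = f y)).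
{ generalize (open_and _ _ (open_gt a) (open_lt b) x Hx).
  apply filter_imp; intros y Hy.
  apply Rle_antisym; [apply Hmono; lra|].
  apply Rle_trans with (f b); [apply Hmono; lra|exact Hba]. }
rewrite <- (is_derive_unique f x (df x)) by auto.
apply is_derive_unique, (is_derive_ext_loc _ _ _ _ Hconst), (is_derive_const (f a) x).
Qed.

(** * Energy estimate near the origin *)

Lemma dot_scal_r (c : R) (z w : C) : dot z (RtoC c * w)%C = c * dot z w.
Proof. unfold dot, Re, Im; simpl; ring. Qed.

Lemma dot_mult_same (c z : C) : dot z (c * z)%C = Re c * Cmod z ^ 2.
Proof. rewrite Cmod2; unfold dot, Re, Im; simpl; ring. Qed.

Lemma dot_plus_r (z w w' : C) : dot z (w + w')%C = dot z w + dot z w'.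
Proof. unfold dot, Re, Im; simpl; ring. Qed.

Lemma dot_minus_r (z w w' : C) : dot z (w - w')%C = dot z w - dot z w'.
Proof. unfold dot, Re, Im; simpl; ring. Qed.

Lemma is_derive_C_eq (f : R -> C) (x : R) (l m : C) :
  is_derive_C f x l -> l = m -> is_derive_C f x m.
Proof. intros H <-; exact H. Qed.

Lemma is_derive_V (x : R) :
  is_derive V x (- 32 * x * (1 - x ^ 2) / (1 + x ^ 2) ^ 3).
Proof.
apply is_derive_ext with (fun t => 2 * (1 - 6 * t ^ 2 + t ^ 4) / (1 + t ^ 2) ^ 2).
{ intros t; symmetry; apply V_rational. }
assert (0 < 1 + x ^ 2) by (generalize (pow2_ge_0 x); lra).
auto_derive.
- apply Rgt_not_eq; simpl in *; nra.
- field; lra.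
Qed.

Ltac push_RtoC :=
  rewrite ?RtoC_div by lra;
  repeat rewrite ?RtoC_inv, ?RtoC_mult, ?RtoC_plus, ?RtoC_opp, ?RtoC_minus, ?RtoC_pow by lra;
  try replace (RtoC 2) with (RtoC 1 + RtoC 1)%C by (rewrite <- RtoC_plus; f_equal; ring).

Lemma Cmult_eq_reg_l (c z w : C) : c <> RtoC 0 -> (c * z = c * w)%C -> z = w.
Proof.
intros Hc H.
replace z with (/ c * (c * z))%C by (field; exact Hc).
rewrite H; field; exact Hc.
Qed.

(** Proves an identity modulo the differential equation [a = b] without solving for the second
    derivative; what remains is left to [field]. *)
Lemma Ceq_transfer (a b z w : C) : a = b -> (z - w = a - b)%C -> z = w.
Proof.
intros -> H.
replace z with ((z - w) + w)%C by ring.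
rewrite H; ring.
Qed.

(* In terms of the header, [core_Y = (1 + x)^s (1 - x^2) h'] and [core_W] is
   [|h_x|^2 - q |h|^2] up to the factor [(1 + x)^(2 Re s) / (1 - x)^2]; written
   with [u] it has no singularity at the origin. *)
Definition core_Y (s : C) (u u1 : R -> C) (x : R) : C :=
  (RtoC (1 - x ^ 2) * (u x + RtoC x * u1 x) - s * RtoC ((1 - x) * x) * u x)%C.

Definition core_W (s : C) (u u1 : R -> C) (x : R) : R :=
  (Cmod (core_Y s u u1 x) ^ 2 - (1 - x ^ 2) * V x * Cmod (u x) ^ 2) / (1 - x) ^ 2.

Lemma is_derive_core_Y (s : C) (u u1 u2 : R -> C) (x : R) :
  regular_solution (1 - s) u u1 u2 -> 0 < x < 1 ->
  is_derive_C (core_Y s u u1) x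
    (RtoC (V x / x) * u x - s * RtoC (/ (1 - x)) * core_Y s u u1 x)%C.
Proof.
intros Hs Hx; unfold core_Y.
pose proof (rs_derive _ _ _ _ Hs x Hx) as Hu.
pose proof (rs_derive1 _ _ _ _ Hs x Hx) as Hu1.
eapply is_derive_C_eq.
{ apply is_derive_C_minus.
  - apply is_derive_C_mult.
    + apply is_derive_C_RtoC; auto_derive; [exact I|reflexivity].
    + apply is_derive_C_plus; [exact Hu|].
      apply is_derive_C_mult; [|exact Hu1].
      apply is_derive_C_RtoC; auto_derive; [exact I|reflexivity].
  - apply is_derive_C_mult; [|exact Hu].
    apply is_derive_C_mult; [apply is_derive_C_const|].
    apply is_derive_C_RtoC; auto_derive; [exact I|reflexivity]. }
assert (Hx0 : RtoC x <> RtoC 0) by (intros Hc; apply RtoC_inj in Hc; lra).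
assert (Hx1 : (RtoC 1 - RtoC x)%C <> RtoC 0)
  by (rewrite <- RtoC_minus; intros Hc; apply RtoC_inj in Hc; lra).
assert (HE := rs_eq _ _ _ _ Hs x (conj (Rlt_le _ _ (proj1 Hx)) (Rlt_le _ _ (proj2 Hx)))).
(* After multiplication by [x], the difference of the sides is exactly that of [rs_eq]. *)
apply (Cmult_eq_reg_l (RtoC x) _ _ Hx0), (Ceq_transfer _ _ _ _ HE); cbv beta.
push_RtoC.
field; split; assumption.
Qed.

(** The coefficient of |u|^2 in the derivative of [core_W], up to (1 - x)^2. Its last term is -(1 -
    x^2) V'. *)
Definition core_coeff (a x : R) : R :=
  V x * (2 * (1 - x ^ 2) / x - 2 * a * (1 - x) + 2 * x - 2 * (1 + x))
  + 32 * x * (1 - x ^ 2) ^ 2 / (1 + x ^ 2) ^ 3.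

(** The weight (1 + x)^(2 Re s) / (1 - x)^2 absorbs the damping term - 4 (Re s) |h_x|^2: the
    coefficient left over, 2 (1 - Re s) / (1 - x), is nonnegative for Re s <= 1. *)
Lemma is_derive_core_W (s : C) (u u1 u2 : R -> C) (x : R) :
  regular_solution (1 - s) u u1 u2 -> 0 < x < 1 ->
  is_derive (core_W s u u1) x
    ((2 * (1 - Re s) / (1 - x) * Cmod (core_Y s u u1 x) ^ 2
      + core_coeff (Re s) x * Cmod (u x) ^ 2) / (1 - x) ^ 2).
Proof.
intros Hs Hx.
pose proof (is_derive_Cmod2 _ _ _ (is_derive_core_Y s u u1 u2 x Hs Hx)) as HY.
pose proof (is_derive_Cmod2 _ _ _ (rs_derive _ _ _ _ Hs x Hx)) as HU.
pose proof (is_derive_V x) as HV.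
assert (Hgen : forall F G W dF dG dW, is_derive F x dF -> is_derive G x dG -> is_derive W x dW ->
  is_derive (fun t => (F t - (1 - t ^ 2) * W t * G t) / (1 - t) ^ 2) x
    ((dF + 2 * x * W x * G x - (1 - x ^ 2) * dW * G x - (1 - x ^ 2) * W x * dG) / (1 - x) ^ 2
     + 2 * (F x - (1 - x ^ 2) * W x * G x) / (1 - x) ^ 3)).
{ clear - Hx; intros F G W dF dG dW HF HG HW.
  auto_derive.
  - repeat split; try (eexists; eassumption); apply Rgt_not_eq; simpl in *; nra.
  - replace (Derive (fun t => F t) x) with dF by (symmetry; exact (is_derive_unique _ _ _ HF)).
    replace (Derive (fun t => G t) x) with dG by (symmetry; exact (is_derive_unique _ _ _ HG)).
    replace (Derive (fun t => W t) x) with dW by (symmetry; exact (is_derive_unique _ _ _ HW)).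
    field; lra. }
evar_last.
{ exact (Hgen _ _ _ _ _ _ HY HU HV). }
clear Hgen HY HU HV.
  assert (HYu : dot (core_Y s u u1 x) (u x) =
    (1 - x ^ 2) * (Cmod (u x) ^ 2 + x * dot (u x) (u1 x))
    - Re s * (1 - x) * x * Cmod (u x) ^ 2).
  { rewrite Cmod2; unfold core_Y, dot, Re, Im; simpl; ring. }
  rewrite dot_minus_r, dot_scal_r, HYu.
  replace (s * RtoC (/ (1 - x)) * core_Y s u u1 x)%C
    with (RtoC (/ (1 - x)) * (s * core_Y s u u1 x))%C by ring.
  rewrite dot_scal_r, dot_mult_same.
  unfold core_coeff.
  field; repeat split; try lra; apply Rgt_not_eq; nra.
Qed.

(** The first positive zero of [V] is tan(pi/8) = sqrt 2 - 1, beyond 1/3. *)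
Lemma core_V_pos (x : R) : 0 <= x <= 1 / 3 -> 0 < V x.
Proof.
intros Hx; rewrite V_rational; apply Rdiv_lt_0_compat; [nra|].
apply pow_lt; nra.
Qed.

Lemma core_coeff_pos (a x : R) : a <= 1 -> 0 < x < 1 / 3 -> 0 < core_coeff a x.
Proof.
intros Ha Hx; unfold core_coeff.
assert (HV : 0 < V x) by (apply core_V_pos; lra).
assert (Hi : 3 < / x) by (apply Rmult_lt_reg_l with x; [lra|]; rewrite Rinv_r; lra).
(* At a = 1 the factor of [V x] is 2/x - 4, which is positive for x < 1/3; a smaller [a] only
   increases it. *)
apply Rplus_le_lt_0_compat.
- apply Rmult_le_pos; [lra|].
  replace (2 * (1 - x ^ 2) / x) with (2 * / x - 2 * x) by (field; lra).
  assert (a * (1 - x) <= 1 - x) by nra.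
  lra.
- apply Rdiv_lt_0_compat; [|apply pow_lt; nra].
  apply Rmult_lt_0_compat; [lra|apply pow_lt; nra].
Qed.

(** At 0 the multiplied equation reduces to V(0) u(0) = 0, with V(0) = 2. *)
Lemma regular_solution_at_0 (lambda : C) (u u1 u2 : R -> C) :
  regular_solution lambda u u1 u2 -> u 0 = RtoC 0.
Proof.
intros Hs; assert (HE := rs_eq _ _ _ _ Hs 0 (conj (Rle_refl 0) Rle_0_1)).
assert (HV : V 0 = 2) by (rewrite V_rational; field).
rewrite HV in HE.
replace (0 ^ 2) with 0 in HE by ring.
replace (0 * (1 - 0)) with 0 in HE by ring.
apply (Cmult_eq_reg_l (RtoC 2)).
- intros Hc; apply RtoC_inj in Hc; lra.
- match type of HE with ?A = ?B => apply (Ceq_transfer _ _ _ _ (eq_sym HE)) end; ring.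
Qed.

Lemma continuity_pt_core_W (s : C) (u u1 u2 : R -> C) (x : R) :
  regular_solution (1 - s) u u1 u2 -> x < 1 -> continuity_pt (core_W s u u1) x.
Proof.
intros Hs Hx.
pose proof (rs_cont _ _ _ _ Hs x) as Hu.
pose proof (rs_cont1 _ _ _ _ Hs x) as Hu1.
apply (continuity_pt_mult (fun t => Cmod (core_Y s u u1 t) ^ 2 - (1 - t ^ 2) * V t * Cmod (u t) ^ 2)
  (fun t => / (1 - t) ^ 2)).
- apply (continuity_pt_minus (fun t => Cmod (core_Y s u u1 t) ^ 2)).
  + apply continuity_pt_Cmod2; unfold core_Y.
    repeat first [ assumption | apply continuous_C_const
      | apply continuous_C_minus | apply continuous_C_plus | apply continuous_C_mult
      | apply continuous_C_RtoC, ex_derive_continuity_pt; auto_derive; exact I ].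
  + apply (continuity_pt_mult (fun t => (1 - t ^ 2) * V t)).
    * apply (continuity_pt_mult (fun t => 1 - t ^ 2)).
      -- apply ex_derive_continuity_pt; auto_derive; exact I.
      -- apply ex_derive_continuity_pt, ex_derive_V.
    * apply continuity_pt_Cmod2, Hu.
- apply ex_derive_continuity_pt; auto_derive; apply Rgt_not_eq; nra.
Qed.

(** Only the term in [core_Y] is dropped; the one in |u|^2 is kept because [core_vanishing] reads
    off [u = 0] from it. *)
Lemma core_W_derive_nonneg (s : C) (u u1 : R -> C) (x : R) :
  Re s <= 1 -> 0 < x < 1 / 3 ->
  core_coeff (Re s) x * Cmod (u x) ^ 2 / (1 - x) ^ 2 <=
  (2 * (1 - Re s) / (1 - x) * Cmod (core_Y s u u1 x) ^ 2
      + core_coeff (Re s) x * Cmod (u x) ^ 2) / (1 - x) ^ 2.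
Proof.
intros Ha Hx.
apply Rmult_le_compat_r; [left; apply Rinv_0_lt_compat, pow_lt; lra|].
assert (0 <= 2 * (1 - Re s) / (1 - x) * Cmod (core_Y s u u1 x) ^ 2); [|lra].
apply Rmult_le_pos; [|apply pow2_ge_0].
apply Rmult_le_pos; [lra|left; apply Rinv_0_lt_compat; lra].
Qed.

Lemma core_W_0 (s : C) (u u1 u2 : R -> C) :
  regular_solution (1 - s) u u1 u2 -> core_W s u u1 0 = 0.
Proof.
intros Hs; unfold core_W, core_Y.
rewrite (regular_solution_at_0 _ _ _ _ Hs), 2!Cmod2; unfold Re, Im; simpl; field.
Qed.

Lemma core_W_nonneg (s : C) (u u1 u2 : R -> C) :
  regular_solution (1 - s) u u1 u2 -> Re s <= 1 -> 0 <= core_W s u u1 (1 / 3).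
Proof.
intros Hs Ha; rewrite <- (core_W_0 s u u1 u2 Hs).
eapply nondecreasing_from_derive.
- lra.
- intros x Hx; apply (continuity_pt_core_W s u u1 u2 x Hs); lra.
- intros x Hx; apply (is_derive_core_W s u u1 u2 x Hs); lra.
- intros x Hx; eapply Rle_trans; [|apply core_W_derive_nonneg; lra].
  apply Rmult_le_pos; [|left; apply Rinv_0_lt_compat, pow_lt; lra].
  apply Rmult_le_pos; [left; apply core_coeff_pos; lra|apply pow2_ge_0].
Qed.

Lemma core_vanishing (s : C) (u u1 u2 : R -> C) :
  regular_solution (1 - s) u u1 u2 -> Re s <= 1 -> core_W s u u1 (1 / 3) <= 0 ->
  forall x, 0 < x < 1 / 3 -> u x = RtoC 0.
Proof.
intros Hs Ha HW x Hx.
assert (Hpos : forall y, 0 < y < 1 / 3 ->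
  0 <= core_coeff (Re s) y * Cmod (u y) ^ 2 / (1 - y) ^ 2).
{ intros y Hy.
  apply Rmult_le_pos; [|left; apply Rinv_0_lt_compat, pow_lt; lra].
  apply Rmult_le_pos; [left; apply core_coeff_pos; lra|apply pow2_ge_0]. }
rewrite <- (core_W_0 s u u1 u2 Hs) in HW.
assert (H0 := derive_zero_of_nondecreasing (core_W s u u1) _ 0 (1 / 3)
  (fun y Hy => continuity_pt_core_W s u u1 u2 y Hs ltac:(lra))
  (fun y Hy => is_derive_core_W s u u1 u2 y Hs ltac:(lra))
  (fun y Hy => Rle_trans _ _ _ (Hpos y Hy) (core_W_derive_nonneg s u u1 y Ha Hy))
  HW x Hx).
assert (Hle := core_W_derive_nonneg s u u1 x Ha Hx); rewrite H0 in Hle.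
destruct (Ceq_dec (u x) (RtoC 0)) as [|Hne]; [assumption|exfalso].
revert Hle; apply Rlt_not_le.
apply Rdiv_lt_0_compat; [|apply pow_lt; lra].
apply Rmult_lt_0_compat; [apply core_coeff_pos; lra|apply pow_lt, Cmod_gt_0, Hne].
Qed.

(** * Riccati comparison near the light cone *)

(** V / (2 x^2), the numerator of the slope k, in partial fractions with respect to x^2. *)
Definition half_potential (x : R) : R := 1 / x ^ 2 - 8 / (1 + x ^ 2) ^ 2.

Definition half_potential' (x : R) : R := 32 * x / (1 + x ^ 2) ^ 3 - 2 / x ^ 3.

Lemma V_half_potential (x : R) : x <> 0 -> V x = 2 * x ^ 2 * half_potential x.
Proof.
intros Hx; rewrite V_rational; unfold half_potential; field.
split; [|assumption]; generalize (pow2_ge_0 x); lra.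
Qed.

Lemma is_derive_half_potential (x : R) :
  0 < x -> is_derive half_potential x (half_potential' x).
Proof.
intros Hx; unfold half_potential, half_potential'.
auto_derive.
- repeat split; apply Rgt_not_eq; simpl; nra.
- field; split; nra.
Qed.

(** The value of h'/h at which h'' vanishes. *)
Definition wkb_slope (s : C) (x : R) : C := (RtoC (half_potential x) / (s - RtoC x))%C.

(* [(1 + x)^s (h' - k h)] with [k = wkb_slope s]. *)
Definition wkb_defect (s : C) (u u1 : R -> C) (x : R) : C :=
  (u x + RtoC x * u1 x - (s * RtoC (/ (1 + x)) + wkb_slope s x) * (RtoC x * u x))%C.

Lemma is_derive_wkb_slope (s : C) (x : R) :
  (s - RtoC x)%C <> RtoC 0 -> 0 < x ->
  is_derive_C (wkb_slope s) x
    ((RtoC (half_potential' x) + wkb_slope s x) / (s - RtoC x))%C.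
Proof.
intros Hs Hx; unfold wkb_slope.
eapply is_derive_C_eq.
{ apply is_derive_C_mult.
  - apply is_derive_C_RtoC, is_derive_half_potential, Hx.
  - apply is_derive_C_inv; [|exact Hs].
    apply is_derive_C_minus; [apply is_derive_C_const|].
    apply is_derive_C_RtoC; exact (is_derive_id x). }
cbv beta; change (one : R) with 1; field; exact Hs.
Qed.

Lemma is_derive_mode (lambda : C) (u u1 u2 : R -> C) (x : R) :
  regular_solution lambda u u1 u2 -> 0 < x < 1 ->
  is_derive_C (fun t => RtoC t * u t)%C x (u x + RtoC x * u1 x)%C.
Proof.
intros Hs Hx.
eapply is_derive_C_eq.
{ apply is_derive_C_mult; [|exact (rs_derive _ _ _ _ Hs x Hx)].
  apply is_derive_C_RtoC; exact (is_derive_id x). }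
change (one : R) with 1; ring.
Qed.

(* Since [h'' = - 2 (s - x) / (1 - x^2) (h' - k h)], the defect is forced only by
   [(k' + k^2) h], which is of order [1 / s]. *)
Lemma is_derive_wkb_defect (s : C) (u u1 u2 : R -> C) (x : R) :
  regular_solution (1 - s) u u1 u2 -> (s - RtoC x)%C <> RtoC 0 -> 0 < x < 1 ->
  is_derive_C (wkb_defect s u u1) x
    ((RtoC (- (2 / (1 - x ^ 2))) * (s - RtoC x) + RtoC (/ (1 + x)) * s - wkb_slope s x)
       * wkb_defect s u u1 x
     - (wkb_slope s x * (RtoC (half_potential x) + RtoC 1) + RtoC (half_potential' x)) / (s - RtoC x)
       * (RtoC x * u x))%C.
Proof.
intros Hs Hne Hx.
assert (Hk : (wkb_slope s x * (s - RtoC x))%C = RtoC (half_potential x))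
  by (unfold wkb_slope; field; exact Hne).
unfold wkb_defect.
eapply is_derive_C_eq.
{ apply is_derive_C_minus.
  - apply is_derive_C_plus; [exact (rs_derive _ _ _ _ Hs x Hx)|].
    apply is_derive_C_mult; [|exact (rs_derive1 _ _ _ _ Hs x Hx)].
    apply is_derive_C_RtoC; exact (is_derive_id x).
  - apply is_derive_C_mult; [|exact (is_derive_mode _ _ _ _ x Hs Hx)].
    apply is_derive_C_plus; [|apply is_derive_wkb_slope; [exact Hne|lra]].
    apply is_derive_C_mult; [apply is_derive_C_const|].
    apply is_derive_C_RtoC; auto_derive; [lra|reflexivity]. }
change (one : R) with 1.
assert (HE := rs_eq _ _ _ _ Hs x ltac:(lra)).
(* Writing V = 2 x^2 k (s - x) eliminates the potential. The slope and [half_potential' x] can then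
   be arbitrary numbers, and the claim is an algebraic consequence of the equation. *)
rewrite (V_half_potential x) in HE by lra.
rewrite RtoC_mult in HE at 1.
rewrite (RtoC_mult (2 * x ^ 2)), <- Hk in HE; rewrite <- Hk.
generalize (wkb_slope s x) (half_potential' x) HE; clear HE Hk; intros k N' HE.
assert (Hx0 : RtoC x <> RtoC 0) by (intros Hc; apply RtoC_inj in Hc; lra).
assert (Hx1 : (RtoC 1 - RtoC x)%C <> RtoC 0)
  by (rewrite <- RtoC_minus; intros Hc; apply RtoC_inj in Hc; lra).
assert (Hx2 : (RtoC 1 + RtoC x)%C <> RtoC 0)
  by (rewrite <- RtoC_plus; intros Hc; apply RtoC_inj in Hc; lra).
apply (Cmult_eq_reg_l (RtoC x * (RtoC 1 - RtoC x) * (RtoC 1 + RtoC x))%C).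
{ repeat apply Cmult_neq_0; assumption. }
apply (Ceq_transfer _ _ _ _ HE); cbv beta.
rewrite ?Rinv_mult; push_RtoC.
rewrite ?RtoC_div by nra; push_RtoC.
push_RtoC.
field; repeat split; try assumption.
replace (RtoC 1 - RtoC x ^ 2)%C with ((RtoC 1 - RtoC x) * (RtoC 1 + RtoC x))%C by ring.
apply Cmult_neq_0; assumption.
Qed.

(** * Explicit bounds and the supersolution *)

(** The value at 1/3 is 63/25, so the upper bound, with denominators cleared in z = x^2, has the
    factor z - 1/9. The lower bound is chosen symmetric, to bound the absolute value. *)
Lemma half_potential_bounds (x : R) :
  1 / 3 <= x <= 1 -> - (63 / 25) <= half_potential x <= 63 / 25.
Proof.
intros Hx; unfold half_potential.
assert (Hz : 1 / 9 <= x ^ 2 <= 1) by (split; nra).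
generalize (x ^ 2) Hz; clear x Hx Hz; intros z Hz.
assert (Hp : 0 < z * (1 + z) ^ 2) by (apply Rmult_lt_0_compat; [lra|apply pow_lt; lra]).
replace (1 / z - 8 / (1 + z) ^ 2) with (((1 + z) ^ 2 - 8 * z) / (z * (1 + z) ^ 2))
  by (field; lra).
split.
- apply (proj1 (Rle_div_r _ _ _ Hp)); nra.
- apply (proj2 (Rle_div_l _ _ _ Hp)).
  assert (0 <= (z - 1 / 9) * (63 / 25 * z ^ 2 + 108 / 25 * z + 9)); [|nra].
  apply Rmult_le_pos; nra.
Qed.

Lemma bernstein_nonneg (x : R) (i j : nat) : 1 / 3 <= x <= 1 -> 0 <= (3 * x - 1) ^ i * (1 - x) ^ j.
Proof. intros Hx; apply Rmult_le_pos; apply pow_le; lra. Qed.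

(* Positivity of a polynomial of degree at most 9 on [[1/3, 1]] from its
   Bernstein coefficients, which [lra] finds. *)
Ltac bernstein9 x Hx :=
  generalize
    (bernstein_nonneg x 0 9 Hx) (bernstein_nonneg x 1 8 Hx) (bernstein_nonneg x 2 7 Hx)
    (bernstein_nonneg x 3 6 Hx) (bernstein_nonneg x 4 5 Hx) (bernstein_nonneg x 5 4 Hx)
    (bernstein_nonneg x 6 3 Hx) (bernstein_nonneg x 7 2 Hx) (bernstein_nonneg x 8 1 Hx)
    (bernstein_nonneg x 9 0 Hx); lra.

(** The alternatives follow the sign of the derivative. Where it is negative, 32 x / (1 + x^2)^3 >=
    4, with equality at 1, gives the second. Each leads to a polynomial inequality in
    [eta_riccati]. *)
Lemma half_potential'_bounds (x : R) :
  1 / 3 <= x <= 1 ->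
  Rabs (half_potential' x) <= 12 / 5 \/ Rabs (half_potential' x) <= 2 / x ^ 3 - 4.
Proof.
intros Hx; unfold half_potential'.
destruct (Rle_dec 0 (32 * x / (1 + x ^ 2) ^ 3 - 2 / x ^ 3)) as [H|H].
- left; rewrite Rabs_pos_eq by exact H.
  assert (Hp : 0 < x ^ 3 * (1 + x ^ 2) ^ 3)
    by (apply Rmult_lt_0_compat; apply pow_lt; nra).
  replace (32 * x / (1 + x ^ 2) ^ 3 - 2 / x ^ 3) with
    ((32 * x ^ 4 - 2 * (1 + x ^ 2) ^ 3) / (x ^ 3 * (1 + x ^ 2) ^ 3))
    by (field; split; nra).
  apply (proj2 (Rle_div_l _ _ _ Hp)).
  bernstein9 x Hx.
- right; rewrite Rabs_left by lra.
  assert (Hp : 0 < (1 + x ^ 2) ^ 3) by (apply pow_lt; nra).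
  cut (4 <= 32 * x / (1 + x ^ 2) ^ 3); [lra|].
  apply (proj1 (Rle_div_r _ _ _ Hp)).
  bernstein9 x Hx.
Qed.

Lemma Cmod_sub_ge (s : C) (x : R) : 10 <= Rabs (Im s) -> 10 <= Cmod (s - RtoC x).
Proof.
intros Hs; apply Rle_trans with (1 := Hs).
replace (Im s) with (Im (s - RtoC x)%C) by (unfold Im; simpl; ring).
apply (Rle_trans _ _ _ (Rmax_r _ _) (Rmax_Cmod _)).
Qed.

(* Any strict supersolution of the Riccati inequality [eta_riccati] with
   [eta (1 / 3)] below about [2.1] will do; the constants were found numerically. *)
Definition eta (x : R) : R := 13 / 200 / x ^ 3 + 3 / 10 * (1 - x).

Definition eta' (x : R) : R := - (39 / 200 / x ^ 4 + 3 / 10).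

Lemma is_derive_eta (x : R) : 0 < x -> is_derive eta x (eta' x).
Proof.
intros Hx; unfold eta, eta'; auto_derive.
- apply Rgt_not_eq; repeat apply Rmult_lt_0_compat; lra.
- field; lra.
Qed.

Lemma eta_pos (x : R) : 0 < x <= 1 -> 0 < eta x.
Proof.
intros Hx; unfold eta.
apply Rplus_lt_le_0_compat; [apply Rdiv_lt_0_compat; [lra|apply pow_lt; lra]|lra].
Qed.

(** Run backwards from 1, the ratio r = |h' - k h| / |h| grows at most like (2/(1+x) + 2|k|) r + |k'
    + k^2| + r^2. The left side is this bound at r = [eta x], with |k| <= 63/250 and [M] bounding
    the derivative of the half potential. Multiplied by x^6 (1 + x), the claim is polynomial of
    degree at most 9. *)
Lemma eta_riccati (x M : R) :
  1 / 3 <= x < 1 -> M <= 12 / 5 \/ M <= 2 / x ^ 3 - 4 ->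
  (2 / (1 + x) + 2 * (63 / 250)) * eta x + (63 / 250 * (88 / 25) + M) / 10 + eta x ^ 2 < - eta' x.
Proof.
intros Hx HM; unfold eta, eta'.
assert (Hx' : 1 / 3 <= x <= 1) by lra.
(* The Bernstein terms are only nonnegative; this one, positive since x < 1, supplies the
   strictness. *)
assert (Hb : 0 < (1 - x) ^ 9) by (apply pow_lt; lra).
assert (Hx6 : 0 < x ^ 6 * (1 + x)) by (apply Rmult_lt_0_compat; [apply pow_lt|]; lra).
assert (H : forall m, M <= m ->
  0 < (39 / 200 / x ^ 4 + 3 / 10 - ((2 / (1 + x) + 2 * (63 / 250)) * (13 / 200 / x ^ 3 + 3 / 10 * (1 - x))
    + (63 / 250 * (88 / 25) + m) / 10 + (13 / 200 / x ^ 3 + 3 / 10 * (1 - x)) ^ 2)) * (x ^ 6 * (1 + x)) ->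
  (2 / (1 + x) + 2 * (63 / 250)) * (13 / 200 / x ^ 3 + 3 / 10 * (1 - x))
    + (63 / 250 * (88 / 25) + M) / 10 + (13 / 200 / x ^ 3 + 3 / 10 * (1 - x)) ^ 2
  < - - (39 / 200 / x ^ 4 + 3 / 10)).
{ intros m Hm H; rewrite <- (Rmult_0_l (x ^ 6 * (1 + x))) in H.
  apply Rmult_lt_reg_r in H; [lra|exact Hx6]. }
destruct HM as [HM|HM]; apply (H _ HM); clear H HM Hx6.
- match goal with |- 0 < ?e => replace e with
    (x ^ 2 * (39 / 200 + 3 / 10 * x ^ 4) * (1 + x)
     - (2 + 2 * (63 / 250) * (1 + x)) * (13 / 200 * x ^ 3 + 3 / 10 * (1 - x) * x ^ 6)
     - (63 / 250 * (88 / 25) + 12 / 5) / 10 * x ^ 6 * (1 + x)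
     - (1 + x) * (13 / 200 + 3 / 10 * (1 - x) * x ^ 3) ^ 2) by (field; lra) end.
  revert Hb; bernstein9 x Hx'.
- match goal with |- 0 < ?e => replace e with
    (x ^ 2 * (39 / 200 + 3 / 10 * x ^ 4) * (1 + x)
     - (2 + 2 * (63 / 250) * (1 + x)) * (13 / 200 * x ^ 3 + 3 / 10 * (1 - x) * x ^ 6)
     - ((63 / 250 * (88 / 25) - 4) * x ^ 6 + 2 * x ^ 3) / 10 * (1 + x)
     - (1 + x) * (13 / 200 + 3 / 10 * (1 - x) * x ^ 3) ^ 2) by (field; lra) end.
  revert Hb; bernstein9 x Hx'.
Qed.

(** Nonpositive exactly when |h' - k h| <= eta |h|, but with no division by h, which may vanish. The
    normalisation by [eta] puts the same term -eta'/eta in front of |E|^2 and eta^2 |v|^2 in the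
    derivative. *)
Definition tail_D (s : C) (u u1 : R -> C) (x : R) : R :=
  Cmod (wkb_defect s u u1 x) ^ 2 / eta x - eta x * Cmod (RtoC x * u x)%C ^ 2.

Lemma Cmod_sub_neq_0 (s : C) (x : R) : 10 <= Rabs (Im s) -> (s - RtoC x)%C <> RtoC 0.
Proof.
intros Hs; apply Cmod_gt_0; generalize (Cmod_sub_ge s x Hs); lra.
Qed.

Lemma Cmod_div_le (z w : C) (K : R) : 10 <= Cmod w -> Cmod z <= K -> Cmod (z / w)%C <= K / 10.
Proof.
intros Hw Hz.
assert (Hw0 : w <> RtoC 0) by (apply Cmod_gt_0; lra).
rewrite Cmod_div by exact Hw0.
apply (proj2 (Rle_div_l _ _ _ (proj1 (Cmod_gt_0 w) Hw0))).
generalize (Cmod_ge_0 z); nra.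
Qed.

Lemma wkb_slope_bound (s : C) (x : R) :
  10 <= Rabs (Im s) -> 1 / 3 <= x <= 1 -> Cmod (wkb_slope s x) <= 63 / 250.
Proof.
intros Hs Hx.
replace (63 / 250) with (63 / 25 / 10) by field.
apply Cmod_div_le; [apply Cmod_sub_ge, Hs|].
rewrite Cmod_R; apply Rabs_le, half_potential_bounds, Hx.
Qed.

(** The quotient is k' + k^2. The constant 88/25 is 63/25 + 1, and the final 10 bounds |s - x| from
    below. *)
Lemma wkb_forcing_bound (s : C) (x : R) :
  10 <= Rabs (Im s) -> 1 / 3 <= x <= 1 ->
  Cmod ((wkb_slope s x * (RtoC (half_potential x) + RtoC 1) + RtoC (half_potential' x))
    / (s - RtoC x))%C <= (63 / 250 * (88 / 25) + Rabs (half_potential' x)) / 10.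
Proof.
intros Hs Hx.
apply Cmod_div_le; [apply Cmod_sub_ge, Hs|].
eapply Rle_trans; [apply Cmod_triangle|].
rewrite Cmod_R; apply Rplus_le_compat_r.
rewrite <- RtoC_plus, Cmod_mult, Cmod_R.
apply Rmult_le_compat; [apply Cmod_ge_0|apply Rabs_pos|apply wkb_slope_bound; assumption|].
generalize (half_potential_bounds x Hx); intros HN; apply Rabs_le; lra.
Qed.

Lemma Re_bound (z : C) (K : R) : Cmod z <= K -> - K <= Re z <= K.
Proof.
intros Hz; apply Rabs_le_between.
apply Rle_trans with (2 := Hz); apply (Rle_trans _ _ _ (Rmax_l _ _) (Rmax_Cmod _)).
Qed.

(** The derivative of [tail_D] after inserting E' = c E - f v and v' = E + (s/(1+x) + k) v, grouped
    as a quadratic form in E and eta v. *)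
Definition tail_D' (s : C) (u u1 : R -> C) (x : R) : R :=
  let E := wkb_defect s u u1 x in
  let v := (RtoC x * u x)%C in
  let k := wkb_slope s x in
  let c := (RtoC (- (2 / (1 - x ^ 2))) * (s - RtoC x) + RtoC (/ (1 + x)) * s - k)%C in
  let f := ((k * (RtoC (half_potential x) + RtoC 1) + RtoC (half_potential' x)) / (s - RtoC x))%C in
  ((2 * Re c - eta' x / eta x) * Cmod E ^ 2 - 2 * dot (f * v)%C E
   - (eta' x / eta x + 2 * Re (RtoC (/ (1 + x)) * s + k)%C) * (eta x ^ 2 * Cmod v ^ 2)
   - eta x ^ 2 * (2 * dot v E)) / eta x.

Lemma is_derive_tail_D (s : C) (u u1 u2 : R -> C) (x : R) :
  regular_solution (1 - s) u u1 u2 -> 10 <= Rabs (Im s) -> 0 < x < 1 ->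
  is_derive (tail_D s u u1) x (tail_D' s u u1 x).
Proof.
intros Hs Hi Hx.
pose proof (is_derive_Cmod2 _ _ _
  (is_derive_wkb_defect s u u1 u2 x Hs (Cmod_sub_neq_0 s x Hi) Hx)) as HE.
pose proof (is_derive_Cmod2 _ _ _ (is_derive_mode _ u u1 u2 x Hs Hx)) as Hv.
pose proof (is_derive_eta x (proj1 Hx)) as Heta.
assert (Hpos : 0 < eta x) by (apply eta_pos; lra).
assert (Hgen : forall F G h dF dG dh, is_derive F x dF -> is_derive G x dG -> is_derive h x dh ->
  0 < h x ->
  is_derive (fun t => F t / h t - h t * G t) x
    (dF / h x - F x * dh / h x ^ 2 - dh * G x - h x * dG)).
{ clear; intros F G h dF dG dh HF HG Hh Hp.
  auto_derive.
  - repeat split; try (eexists; eassumption); lra.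
  - replace (Derive (fun t => F t) x) with dF by (symmetry; exact (is_derive_unique _ _ _ HF)).
    replace (Derive (fun t => G t) x) with dG by (symmetry; exact (is_derive_unique _ _ _ HG)).
    replace (Derive (fun t => h t) x) with dh by (symmetry; exact (is_derive_unique _ _ _ Hh)).
    field; lra. }
evar_last.
{ exact (Hgen _ _ _ _ _ _ HE Hv Heta Hpos). }
clear Hgen HE Hv Heta; cbv beta; unfold tail_D'; cbv zeta.
replace (u x + RtoC x * u1 x)%C with
  (wkb_defect s u u1 x + (RtoC (/ (1 + x)) * s + wkb_slope s x) * (RtoC x * u x))%C
  by (unfold wkb_defect; ring).
rewrite dot_minus_r, dot_plus_r, !dot_mult_same.
set (f := ((_ + _) / _)%C).
replace (dot (wkb_defect s u u1 x) (f * (RtoC x * u x))%C)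
  with (dot (f * (RtoC x * u x))%C (wkb_defect s u u1 x)) by (unfold dot; ring).
field; lra.
Qed.

(** Both diagonal coefficients are at least [M], and the cross terms cost at most K/eta and eta by
    [two_dot_le]. The remainder M - K/eta - eta is positive, which is [eta_riccati] divided by
    eta. *)
Lemma tail_D'_lower_bound (s : C) (u u1 : R -> C) (x : R) :
  Re s <= 1 -> 10 <= Rabs (Im s) -> 1 / 3 < x < 1 ->
  exists delta, 0 < delta /\
    delta * (Cmod (wkb_defect s u u1 x) ^ 2 + eta x ^ 2 * Cmod (RtoC x * u x)%C ^ 2)
      <= tail_D' s u u1 x.
Proof.
intros Ha Hi Hx.
assert (Hpos : 0 < eta x) by (apply eta_pos; lra).
pose proof (eta_riccati x _ (conj (Rlt_le _ _ (proj1 Hx)) (proj2 Hx))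
  (half_potential'_bounds x ltac:(lra))) as Hric.
pose proof (Re_bound _ _ (wkb_slope_bound s x Hi ltac:(lra))) as Hk.
pose proof (wkb_forcing_bound s x Hi ltac:(lra)) as Hf.
set (K := (63 / 250 * (88 / 25) + Rabs (half_potential' x)) / 10) in *.
set (M := - eta' x / eta x - 2 / (1 + x) - 2 * (63 / 250)).
exists ((M - K / eta x - eta x) / eta x).
assert (Hinv : 0 < / (1 + x)) by (apply Rinv_0_lt_compat; lra).
split.
{ apply Rdiv_lt_0_compat; [|exact Hpos].
  replace (M - K / eta x - eta x) with
    ((- eta' x - ((2 / (1 + x) + 2 * (63 / 250)) * eta x + K + eta x ^ 2)) / eta x)
    by (unfold M; field; lra).
  apply Rdiv_lt_0_compat; lra. }
unfold tail_D'; cbv zeta.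
set (E := wkb_defect s u u1 x).
set (v := (RtoC x * u x)%C).
set (k := wkb_slope s x) in *.
set (f := ((_ + _) / _)%C) in *.
assert (Hfv := two_dot_le f v E K (eta x) Hf Hpos).
assert (Hvv := two_dot_le (RtoC 1) v E 1 (eta x) ltac:(rewrite Cmod_1; lra) Hpos).
rewrite Cmult_1_l in Hvv.
assert (Hamgm : Cmod E ^ 2 / eta x + eta x * Cmod v ^ 2
  = (Cmod E ^ 2 + eta x ^ 2 * Cmod v ^ 2) / eta x) by (field; lra).
rewrite Hamgm in Hfv, Hvv; clear Hamgm.
apply Rabs_le_between in Hfv; apply Rabs_le_between in Hvv.
(* Without k, twice the real part is -2/(1+x) + 2 (1 - Re s)/(1 - x): the part singular at 1 has a
   favourable sign, and Im s does not enter. *)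
assert (Hc : - (2 / (1 + x)) - 2 * (63 / 250) <=
  2 * Re (RtoC (- (2 / (1 - x ^ 2))) * (s - RtoC x) + RtoC (/ (1 + x)) * s - k)%C).
{ replace (Re (RtoC (- (2 / (1 - x ^ 2))) * (s - RtoC x) + RtoC (/ (1 + x)) * s - k)%C)
    with (- (2 / (1 - x ^ 2)) * (Re s - x) + / (1 + x) * Re s - Re k)
    by (unfold Re, Im; simpl; ring).
  assert (0 <= (1 - Re s) * / (1 - x)).
  { apply Rmult_le_pos; [lra|left; apply Rinv_0_lt_compat; lra]. }
  assert (2 * (- (2 / (1 - x ^ 2)) * (Re s - x) + / (1 + x) * Re s)
    = - (2 / (1 + x)) + 2 * ((1 - Re s) * / (1 - x))) by (field; split; nra).
  lra. }
assert (Hm : 2 * Re (RtoC (/ (1 + x)) * s + k)%C <= 2 / (1 + x) + 2 * (63 / 250)).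
{ replace (Re (RtoC (/ (1 + x)) * s + k)%C) with (/ (1 + x) * Re s + Re k)
    by (unfold Re, Im; simpl; ring).
  assert (/ (1 + x) * Re s <= / (1 + x)) by nra.
  unfold Rdiv; lra. }
apply Rmult_le_reg_r with (eta x); [exact Hpos|].
match goal with |- _ <= ?A / ?B * ?B => replace (A / B * B) with A by (field; lra) end.
replace ((M - K / eta x - eta x) / eta x * (Cmod E ^ 2 + eta x ^ 2 * Cmod v ^ 2) * eta x)
  with (M * Cmod E ^ 2 + M * (eta x ^ 2 * Cmod v ^ 2)
    - K * ((Cmod E ^ 2 + eta x ^ 2 * Cmod v ^ 2) / eta x)
    - eta x ^ 2 * (1 * ((Cmod E ^ 2 + eta x ^ 2 * Cmod v ^ 2) / eta x))) by (field; lra).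
assert (HX : 0 <= Cmod E ^ 2) by apply pow2_ge_0.
assert (HT : 0 <= eta x ^ 2 * Cmod v ^ 2) by (apply Rmult_le_pos; apply pow2_ge_0).
assert (Hdot : eta x ^ 2 * (2 * dot v E) <=
  eta x ^ 2 * (1 * ((Cmod E ^ 2 + eta x ^ 2 * Cmod v ^ 2) / eta x))).
{ apply Rmult_le_compat_l; [apply pow2_ge_0|lra]. }
assert (HM1 : M * Cmod E ^ 2 <=
  (2 * Re (RtoC (- (2 / (1 - x ^ 2))) * (s - RtoC x) + RtoC (/ (1 + x)) * s - k)%C
   - eta' x / eta x) * Cmod E ^ 2).
{ apply Rmult_le_compat_r; [exact HX|unfold M, Rdiv in *; lra]. }
assert (HM2 : M * (eta x ^ 2 * Cmod v ^ 2) <=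
  - (eta' x / eta x + 2 * Re (RtoC (/ (1 + x)) * s + k)%C) * (eta x ^ 2 * Cmod v ^ 2)).
{ apply Rmult_le_compat_r; [exact HT|unfold M, Rdiv in *; lra]. }
lra.
Qed.

Lemma continuity_pt_tail_D (s : C) (u u1 u2 : R -> C) (x : R) :
  regular_solution (1 - s) u u1 u2 -> 10 <= Rabs (Im s) -> 0 < x <= 1 ->
  continuity_pt (tail_D s u u1) x.
Proof.
intros Hs Hi Hx.
pose proof (rs_cont _ _ _ _ Hs x) as Hu.
pose proof (rs_cont1 _ _ _ _ Hs x) as Hu1.
assert (Hid : continuous_C (fun t => RtoC t) x)
  by (apply continuous_C_RtoC, continuity_pt_id).
assert (Heta : continuity_pt eta x).
{ apply ex_derive_continuity_pt; eexists; apply is_derive_eta; lra. }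
assert (Hk : continuous_C (wkb_slope s) x).
{ destruct (is_derive_wkb_slope s x (Cmod_sub_neq_0 s x Hi) (proj1 Hx)) as [Hr Hi'].
  split; apply ex_derive_continuity_pt; eexists; eassumption. }
apply (continuity_pt_minus (fun t => Cmod (wkb_defect s u u1 t) ^ 2 / eta t)).
- apply (continuity_pt_div (fun t => Cmod (wkb_defect s u u1 t) ^ 2)); [|exact Heta|].
  + apply continuity_pt_Cmod2; unfold wkb_defect.
    repeat first [ assumption | apply continuous_C_const
      | apply continuous_C_minus | apply continuous_C_plus | apply continuous_C_mult ].
    apply continuous_C_RtoC, ex_derive_continuity_pt; auto_derive; lra.
  + apply Rgt_not_eq, eta_pos, Hx.
- apply (continuity_pt_mult eta); [exact Heta|].
  apply continuity_pt_Cmod2, continuous_C_mult; assumption.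
Qed.

(** The leading coefficient vanishes at 1, so the equation, valid up to this endpoint by smoothness,
    becomes the boundary condition h' = k h. *)
Lemma wkb_defect_at_1 (s : C) (u u1 u2 : R -> C) :
  regular_solution (1 - s) u u1 u2 -> 10 <= Rabs (Im s) -> wkb_defect s u u1 1 = RtoC 0.
Proof.
intros Hs Hi.
assert (HE := rs_eq _ _ _ _ Hs 1 ltac:(lra)).
assert (Hne := Cmod_sub_neq_0 s 1 Hi).
rewrite V_rational in HE; unfold wkb_defect, wkb_slope, half_potential.
replace (1 / 1 ^ 2 - 8 / (1 + 1 ^ 2) ^ 2) with (- (1)) by field.
replace (2 * (1 - 6 * 1 ^ 2 + 1 ^ 4) / (1 + 1 ^ 2) ^ 2) with (- (1 + 1)) in HE by field.
replace (1 ^ 2 * (1 - 1 ^ 2)) with 0 in HE by ring.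
replace (2 * (1 - 1 ^ 2)) with 0 in HE by ring.
replace (1 ^ 2) with 1 in HE by ring.
assert (H2 : (RtoC 1 + RtoC 1)%C <> RtoC 0)
  by (rewrite <- RtoC_plus; intros Hc; apply RtoC_inj in Hc; lra).
apply (Cmult_eq_reg_l ((RtoC 1 + RtoC 1) * (s - RtoC 1))%C).
{ apply Cmult_neq_0; assumption. }
apply (Ceq_transfer _ _ _ _ HE).
push_RtoC.
field; exact Hne.
Qed.

Lemma tail_D_1 (s : C) (u u1 u2 : R -> C) :
  regular_solution (1 - s) u u1 u2 -> 10 <= Rabs (Im s) -> tail_D s u u1 1 <= 0.
Proof.
intros Hs Hi; unfold tail_D.
rewrite (wkb_defect_at_1 s u u1 u2 Hs Hi), Cmod_0.
assert (0 <= eta 1 * Cmod (RtoC 1 * u 1)%C ^ 2).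
{ apply Rmult_le_pos; [left; apply eta_pos; lra|apply pow2_ge_0]. }
replace (0 ^ 2 / eta 1) with 0 by (unfold Rdiv; ring); lra.
Qed.

Lemma tail_D'_nonneg (s : C) (u u1 : R -> C) (x : R) :
  Re s <= 1 -> 10 <= Rabs (Im s) -> 1 / 3 < x < 1 -> 0 <= tail_D' s u u1 x.
Proof.
intros Ha Hi Hx.
destruct (tail_D'_lower_bound s u u1 x Ha Hi Hx) as [d [Hd Hle]].
apply Rle_trans with (2 := Hle).
apply Rmult_le_pos; [lra|].
apply Rplus_le_le_0_compat; [apply pow2_ge_0|apply Rmult_le_pos; apply pow2_ge_0].
Qed.

(** The backward comparison: [tail_D] is nondecreasing on [1/3, 1] and nonpositive at 1. *)
Lemma tail_D_nonpos (s : C) (u u1 u2 : R -> C) :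
  regular_solution (1 - s) u u1 u2 -> Re s <= 1 -> 10 <= Rabs (Im s) ->
  tail_D s u u1 (1 / 3) <= 0.
Proof.
intros Hs Ha Hi.
apply Rle_trans with (2 := tail_D_1 s u u1 u2 Hs Hi).
apply (nondecreasing_from_derive _ (tail_D' s u u1)); [lra| | |].
- intros x Hx; apply (continuity_pt_tail_D s u u1 u2); auto; lra.
- intros x Hx; apply (is_derive_tail_D s u u1 u2); auto; lra.
- intros x Hx; apply tail_D'_nonneg; auto.
Qed.

Lemma tail_vanishing (s : C) (u u1 u2 : R -> C) :
  regular_solution (1 - s) u u1 u2 -> Re s <= 1 -> 10 <= Rabs (Im s) ->
  0 <= tail_D s u u1 (1 / 3) ->
  forall x, 1 / 3 < x < 1 -> u x = RtoC 0.
Proof.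
intros Hs Ha Hi HD x Hx.
assert (H0 := derive_zero_of_nondecreasing (tail_D s u u1) (tail_D' s u u1) (1 / 3) 1
  (fun y Hy => continuity_pt_tail_D s u u1 u2 y Hs Hi ltac:(lra))
  (fun y Hy => is_derive_tail_D s u u1 u2 y Hs Hi ltac:(lra))
  (fun y Hy => tail_D'_nonneg s u u1 y Ha Hi Hy)
  (Rle_trans _ _ _ (tail_D_1 s u u1 u2 Hs Hi) HD) x Hx).
destruct (tail_D'_lower_bound s u u1 x Ha Hi Hx) as [d [Hd Hle]].
rewrite H0 in Hle.
destruct (Ceq_dec (u x) (RtoC 0)) as [|Hne]; [assumption|exfalso].
revert Hle; apply Rlt_not_le, Rmult_lt_0_compat; [exact Hd|].
apply Rplus_le_lt_0_compat; [apply pow2_ge_0|].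
apply Rmult_lt_0_compat; [apply pow_lt, eta_pos; lra|].
apply pow_lt, Cmod_gt_0, Cmult_neq_0; [|exact Hne].
intros Hc; apply RtoC_inj in Hc; lra.
Qed.

(** * Matching at 1/3 and conclusion *)

(** With v = u/3 at 1/3, the core estimate gives |Y|^2 >= 4.48 |v|^2, so |Y| >= 2.11 |v|. The tail
    estimate gives |Y| <= (8/9)(391/200 + 63/250) |v| <= 1.97 |v|. Hence v = 0, and all the
    quantities vanish. *)
Lemma core_tail_matching (s : C) (u u1 : R -> C) :
  10 <= Rabs (Im s) -> 0 <= core_W s u u1 (1 / 3) -> tail_D s u u1 (1 / 3) <= 0 ->
  u (1 / 3) = RtoC 0 /\ core_W s u u1 (1 / 3) <= 0 /\ 0 <= tail_D s u u1 (1 / 3).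
Proof.
intros Hi HW HD.
assert (Hk := wkb_slope_bound s (1 / 3) Hi ltac:(lra)).
assert (HV : V (1 / 3) = 14 / 25) by (rewrite V_rational; field).
assert (Heta : eta (1 / 3) = 391 / 200) by (unfold eta; field).
unfold core_W, tail_D in *; rewrite HV in *; rewrite Heta in *.
set (E := wkb_defect s u u1 (1 / 3)) in *.
set (v := (RtoC (1 / 3) * u (1 / 3)%R)%C) in *.
assert (HY : core_Y s u u1 (1 / 3) = (RtoC (8 / 9) * (E + wkb_slope s (1 / 3)%R * v))%C).
{ unfold core_Y, E, wkb_defect; fold v.
  replace (RtoC (1 - (1 / 3) ^ 2)) with (RtoC (8 / 9)) by (f_equal; field).
  replace (s * RtoC ((1 - 1 / 3) * (1 / 3)) * u (1 / 3)%R)%C with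
    (RtoC (8 / 9) * (s * RtoC (/ (1 + 1 / 3)) * v))%C.
  { ring. }
  unfold v.
  replace (RtoC ((1 - 1 / 3) * (1 / 3)))
    with (RtoC (8 / 9) * RtoC (/ (1 + 1 / 3)) * RtoC (1 / 3))%C
    by (rewrite <- !RtoC_mult; f_equal; field).
  ring. }
assert (Hu : Cmod (u (1 / 3)) = 3 * Cmod v).
{ unfold v; rewrite Cmod_mult, Cmod_R, Rabs_pos_eq by lra; field. }
assert (HYle : Cmod (core_Y s u u1 (1 / 3)) <= 8 / 9 * (Cmod E + 63 / 250 * Cmod v)).
{ rewrite HY, Cmod_mult, Cmod_R, Rabs_pos_eq by lra.
  apply Rmult_le_compat_l; [lra|].
  eapply Rle_trans; [apply Cmod_triangle|]; rewrite Cmod_mult.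
  apply Rplus_le_compat_l, Rmult_le_compat_r; [apply Cmod_ge_0|exact Hk]. }
rewrite Hu in *.
generalize (Cmod_ge_0 (core_Y s u u1 (1 / 3))) (Cmod_ge_0 E) (Cmod_ge_0 v).
set (y := Cmod (core_Y s u u1 (1 / 3))) in *.
set (e := Cmod E) in *; set (w := Cmod v) in *.
intros Hy He Hw.
replace ((y ^ 2 - (1 - (1 / 3) ^ 2) * (14 / 25) * (3 * w) ^ 2) / (1 - 1 / 3) ^ 2)
  with (9 / 4 * y ^ 2 - 252 / 25 * w ^ 2) in * by field.
assert (He' : e <= 391 / 200 * w).
{ apply Rnot_lt_le; intros Hlt.
  assert ((391 / 200 * w) ^ 2 < e ^ 2) by nra.
  lra. }
assert (Hyw : y <= 197 / 100 * w) by lra.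
(* Since (9/4) 1.97^2 < 252/25, the two bounds on [y] are compatible only for [w = 0]. *)
assert (Hw0 : w = 0) by nra.
assert (Hy0 : y = 0) by lra; assert (He0 : e = 0) by lra.
split; [apply Cmod_eq_0; lra|rewrite Hw0, Hy0, He0; lra].
Qed.

Lemma regular_solution_zero (s : C) (u u1 u2 : R -> C) :
  regular_solution (1 - s) u u1 u2 -> Re s <= 1 -> 10 <= Rabs (Im s) ->
  forall x, 0 <= x <= 1 -> u x = RtoC 0.
Proof.
intros Hs Ha Hi.
destruct (core_tail_matching s u u1 Hi (core_W_nonneg s u u1 u2 Hs Ha)
  (tail_D_nonpos s u u1 u2 Hs Ha Hi)) as [Hu [HW HD]].
apply C_zero_on_closed_01; [exact (rs_cont _ _ _ _ Hs)|].
intros x Hx.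
destruct (Rtotal_order x (1 / 3)) as [Hlt|[->|Hgt]].
- apply (core_vanishing s u u1 u2 Hs Ha HW); lra.
- exact Hu.
- apply (tail_vanishing s u u1 u2 Hs Ha Hi HD); lra.
Qed.

Theorem theorem1p4 (lambda : C)
    (Hre : 0 <= Re lambda <= 1 / 2)
    (Him : 10 <= Rabs (Im lambda) <= 380) :
  ~ exists u : R -> C, unstable_mode lambda u.
Proof.
intros [u Hu].
destruct (unstable_mode_regular_solution lambda u Hu) as [w [w1 [w2 [Hs [x [Hx Hne]]]]]].
(* The choice s = 1 - lambda turns Re lambda >= 0 into Re s <= 1 and preserves |Im lambda|. *)
apply Hne, (regular_solution_zero (1 - lambda) w w1 w2); [| | |exact Hx].
- replace (1 - (1 - lambda))%C with lambda by ring; exact Hs.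
- unfold Re in *; simpl; lra.
- replace (Im (1 - lambda)%C) with (- Im lambda) by (unfold Im; simpl; ring).
  rewrite Rabs_Ropp; lra.
Qed.
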